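(* There exist absolute constants $C,a,b\in(0,\infty)$ with $a\le b$ such that the following holds. Let $1\le p\le\infty$ with Hölder conjugate $p^*$, let $\sigma=(\sigma_j)_{j\in\mathbb{N}}$ be a sequence with $\sigma_1\ge\sigma_2\ge\cdots\ge 0$, and let $n\in\mathbb{N}$. Then there is a real number $k>0$, with $an\le k\le bn$ if $p=1$ and with $a\frac n{p^*}\le k\le b\frac n{p^*}$ if $p>1$, such that $$ c_n(D_\sigma:\ell_p\to\ell_2)\le \begin{cases} C\,n^{-1/2}\sup\limits_{j\ge k}\sigma_j\sqrt{\log(j)+1} & \text{if } p=1,\\ C\,\sqrt{p^*}\,n^{-1/2}\Big(\sum\limits_{j\ge k}\sigma_j^{p^*}\Big)^{1/p^*} & \text{if } 1<p\le\infty, \end{cases} $$ where the supremum and the sum range over integers $j\ge 1$ with $j\ge k$. In particular, if $1<p\le\infty$ and $\sigma\in\ell_{p^*}$, then the sequence $(c_n(D_\sigma:\ell_p\to\ell_2))_{n\in\mathbb{N}}$ belongs to $\ell_{2,\infty}$.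
   Context: $\ell_p$ is the space of (real) $p$-summable sequences (bounded sequences for $p=\infty$) with its usual norm. $D_\sigma$ is the diagonal operator $x=(x_j)_{j\in\mathbb{N}}\mapsto(\sigma_jx_j)_{j\in\mathbb{N}}$. The $n$-th Gelfand number is $c_n(D_\sigma:\ell_p\to\ell_2):=\inf_E\sup\{\|D_\sigma x\|_2:x\in E,\ \|x\|_p\le1\}$, where the infimum is over all closed linear subspaces $E$ of $\ell_p$ of codimension at most $n-1$. All inequalities are understood in $[0,\infty]$ (with $\|y\|_2=\infty$ if $y\notin\ell_2$). The Lorentz space $\ell_{2,\infty}$ consists of the sequences $x$ with $\sup_{j}j^{1/2}x_j^*<\infty$, where $(x_j^* )$ is the non-increasing rearrangement of $(|x_j|)$. The Hölder conjugate satisfies $\frac1p+\frac1{p^*}=1$ (with $1/\infty=0$). *)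

(* Defs.v *)
From HB Require Import structures.
From mathcomp Require Import all_boot all_order all_algebra.
From mathcomp Require Import all_classical all_reals all_analysis.
Set Implicit Arguments.
Unset Strict Implicit.
Unset Printing Implicit Defensive.
Import Order.TTheory GRing.Theory Num.Theory.
Import numFieldNormedType.Exports.
Local Open Scope classical_set_scope.
Local Open Scope ring_scope.

(* A sequence [(x_j)], j = 1, 2, ..., is encoded as [x : nat -> R] with
   [x j] standing for its (j+1)-st term. *)

Section SequenceSpaces.
Variable R : realType.
Implicit Types (p q : \bar R) (x y : nat -> R) (E : set (nat -> R)).

(* The l_p norm is the L^p norm of the counting measure on [nat]; it is [+oo]
   outside l_p, and for [p = +oo] it is the essential supremum, which is the
   supremum because only [set0] is null for the counting measure. *)
Definition ellp_norm p x : \bar R :=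
  ('N[@counting nat R]_p [EFin \o x])%E.

Definition ellp p : set (nat -> R) := [set x | (ellp_norm p x < +oo)%E].

Definition closed_subspace p E : Prop :=
  [/\ E `<=` ellp p,
      E 0,
      (forall (a : R) x y, E x -> E y -> E (a *: x + y)) &
      (forall x, ellp p x ->
         (forall e : R, 0 < e ->
            exists2 y, E y & (ellp_norm p (x - y)%R < e%:E)%E) ->
         E x)].

(* dim (l_p / E) <= m: the quotient is spanned by the classes of [m] vectors. *)
Definition codim_le p E (m : nat) : Prop :=
  exists2 v : 'I_m -> nat -> R,
    (forall i, ellp p (v i)) &
    (forall x, ellp p x ->
       exists c : 'I_m -> R, E (x - \sum_(i < m) c i *: v i)).

(* The index [n] starts at 1; the value at [n = 0] is meaningless. *)
Definition gelfand_number p q (T : (nat -> R) -> (nat -> R)) (n : nat) :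
    \bar R :=
  ereal_inf [set ereal_sup [set ellp_norm q (T x) |
                            x in [set x | E x /\ (ellp_norm p x <= 1)%E]] |
             E in [set E | closed_subspace p E /\ codim_le p E n.-1]].

Definition diag_op (sigma : nat -> R) : (nat -> R) -> (nat -> R) :=
  fun x j => sigma j * x j.

(* [rearrangement x j] is the (j+1)-st term of the non-increasing
   rearrangement of [(|x_i|)]: the least level exceeded by at most [j] terms;
   it is [+oo] if there is no such level. *)
Definition rearrangement x (j : nat) : \bar R :=
  ereal_inf [set t%:E | t in [set t : R |
    0 <= t /\ (counting [set i : nat | (t < `|x i|)%R] <= (j%:R : R)%:E)%E]].

Definition lorentz2oo : set (nat -> R) :=
  [set x | (ereal_sup (range (fun j : nat =>
              (Num.sqrt (j.+1%:R : R))%:E * rearrangement x j)) < +oo)%E].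

End SequenceSpaces.

(* Main.v *)
Require Import Defs.
From HB Require Import structures.
From mathcomp Require Import all_boot all_order all_algebra.
From mathcomp Require Import all_classical all_reals all_analysis.
From mathcomp Require Import ess_sup_inf finmap ring lra zify.
Set Implicit Arguments.
Unset Strict Implicit.
Unset Printing Implicit Defensive.
Import Order.TTheory GRing.Theory Num.Theory.
Import numFieldNormedType.Exports.
Local Open Scope classical_set_scope.
Local Open Scope ring_scope.

(** The theorem is an instance of the low M* estimate: a random subspace of
    codimension [m] meets a set [K] in vectors of l_2 norm at most a constant
    times [w(K) / m], where [w(K)] is the expectation of
    [sup_(y in K) <e_1 + ... + e_m, y>] for independent random sign vectors
    [e_i].  It is applied to the image [K] under [D_sigma] of the unit ball of
    l_p, restricted to finitely many coordinates.

    First, the first [k0 <= k] coordinates are annihilated by [k0 <= n / 4]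
    functionals, and the coordinates beyond a large [M] contribute at most
    [W / sqrt n], where [W] is the norm or the supremum of [sigma] on the right
    of the assertion ([gelfand_diag_window]).  This leaves the window [0, M) and
    [m >= n / 4] functionals.

    The estimate itself rests on two facts.  By Khinchine's inequality the mean
    of [|<e, y>|] is at least half the l_2 norm of [y] ([khinchine_l1]).  And
    the expectation of the supremum over [K] of
    [m E|<e, y>| - sum_i |<e_i, y>|] is at most that of
    [2 <e_1 + ... + e_m, y>] ([avg_comparison], [exists_sign_vectors]); this
    combines symmetrization with the contraction principle for the absolute
    value, and is proved for one vector at a time by exchanging it with an
    independent copy.  Choosing an outcome not worse than the average gives
    sign vectors on whose common kernel [m] times the l_2 norm is bounded
    ([kernel_norm_le]).  All averages are finite sums.

    What remains is to bound [w(K)], the expected dual norm of [(sigma_j s_j)_j],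
    where the [s_j] are sums of [m] random signs.  In both cases this norm is
    majorized by a constant plus a combination of [exp (l_j s_j)] and
    [exp (- l_j s_j)], whose expectation is explicit because
    [E exp (l s_j) = cosh(l)^m <= exp (2 m l^2)].  For [p > 1] (conjugate
    exponent [q]) the [q]-th moments of the [s_j], of order [(q m)^(q/2)], yield
    [w(K) <= C sqrt (q m) |sigma|_q] ([gelfand_diag_pgt1]); for [p = 1] a union
    bound over [j] yields [w(K) <= C sqrt m sup_j sigma_j sqrt (ln (j + 1) + 1)]
    ([gelfand_diag_p1]).  Division by [m], which is of the order of [n], gives
    the two bounds, and the decay [n^(-1/2)] for [sigma] in l_q is exactly
    membership in the weak l_2 space ([lorentz2oo_le]). *)

(** * Averages over random signs *)
Section SignAverages.
Variables (R : realType) (N : nat).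

Notation signs := {ffun 'I_N -> bool}.
Notation vec := ('I_N -> R).

Definition avg (F : signs -> R) : R := (\sum_e F e) / #|{: signs}|%:R.

Definition sign_vec (e : signs) : vec := fun j => (-1) ^+ e j.

Definition dot (s y : vec) : R := \sum_j s j * y j.

Definition flip (P : pred 'I_N) (e : signs) : signs := [ffun j => P j (+) e j].

Let card_signs_gt0 : 0 < #|{: signs}|%:R :> R.
Proof. by rewrite ltr0n; apply/card_gt0P; exists [ffun => false]. Qed.

Lemma avgD F G : avg (fun e => F e + G e) = avg F + avg G.
Proof. by rewrite /avg big_split mulrDl. Qed.

Lemma avgZ a F : avg (fun e => a * F e) = a * avg F.
Proof. by rewrite /avg -mulr_sumr mulrA. Qed.

Lemma avg_cst a : avg (fun=> a) = a.
Proof. by rewrite /avg sumr_const -[a *+ _]mulr_natr mulfK// gt_eqF. Qed.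

Lemma avgN F : avg (fun e => - F e) = - avg F.
Proof. by rewrite /avg sumrN mulNr. Qed.

Lemma avg_sum (I : finType) (F : I -> signs -> R) :
  avg (fun e => \sum_i F i e) = \sum_i avg (F i).
Proof. by rewrite /avg exchange_big/= mulr_suml. Qed.

Lemma eq_avg F G : F =1 G -> avg F = avg G.
Proof. by move=> FG; rewrite /avg (eq_bigr _ (fun e _ => FG e)). Qed.

Lemma ler_avg F G : (forall e, F e <= G e) -> avg F <= avg G.
Proof.
by move=> FG; rewrite ler_wpM2r ?invr_ge0 ?ler0n//; apply: ler_sum.
Qed.

Lemma avg_exchange (F : signs -> signs -> R) :
  avg (fun e => avg (F e)) = avg (fun e' => avg (F^~ e')).
Proof. by rewrite /avg -2!mulr_suml exchange_big. Qed.

Lemma exists_le_avg F : exists e, F e <= avg F.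
Proof.
apply: contrapT => /forallNP h.
have : avg F < avg F; last by rewrite ltxx.
rewrite {2}/avg ltr_pdivlMr//.
have -> : avg F * #|{: signs}|%:R = \sum_(e : signs) avg F.
  by rewrite sumr_const mulr_natr.
apply: ltr_sum.
  by apply/hasP; exists [ffun => false]; rewrite ?mem_index_enum.
by move=> e _; rewrite ltNge; apply/negP; exact: h.
Qed.

Lemma flipK P : involutive (flip P).
Proof. by move=> e; apply/ffunP => j; rewrite !ffunE addbA addbb. Qed.

Lemma avg_flip P F : avg (fun e => F (flip P e)) = avg F.
Proof.
by rewrite /avg [in RHS](reindex_inj (inv_inj (flipK P))).
Qed.

Lemma sign_vec_flip P e j : sign_vec (flip P e) j = (-1) ^+ P j * sign_vec e j.
Proof. by rewrite /sign_vec ffunE signr_addb. Qed.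

Lemma dotDl s t y : dot (s + t) y = dot s y + dot t y.
Proof. by rewrite /dot -big_split; apply: eq_bigr => j _;
  rewrite /= mulrDl. Qed.

Lemma dot0l y : dot 0 y = 0.
Proof. by rewrite /dot big1// => j _; rewrite mul0r. Qed.

Lemma dot_flipT e y : dot (sign_vec (flip predT e)) y = - dot (sign_vec e) y.
Proof.
rewrite /dot -sumrN; apply: eq_bigr => j _.
by rewrite sign_vec_flip/= expr1 mulN1r mulNr.
Qed.

Definition mean_abs (y : vec) : R := avg (fun e => `|dot (sign_vec e) y|).

Let partial_dot (y : vec) (n : nat) (e : signs) : R :=
  \sum_(j < N | (j < n)%N) sign_vec e j * y j.

Let partial_dotS y n (nN : (n < N)%N) e :
  partial_dot y n.+1 e =
    partial_dot y n e + sign_vec e (Ordinal nN) * y (Ordinal nN).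
Proof.
rewrite /partial_dot (bigD1 (Ordinal nN))//= addrC; congr (_ + _).
apply: eq_bigl => j; rewrite ltnS -val_eqE/=.
by rewrite andbC -ltn_neqAle.
Qed.

(** Flipping the [n]-th sign leaves the first [n] terms alone, so averaging over
    that sign alone replaces [f] by the mean of its values at two points. *)
Let avg_partial_dotS y n (nN : (n < N)%N) (f : R -> R) :
  avg (fun e => f (partial_dot y n.+1 e)) =
  avg (fun e => 2^-1 * (f (partial_dot y n e + y (Ordinal nN)) +
                        f (partial_dot y n e - y (Ordinal nN)))).
Proof.
pose i := Ordinal nN.
have partial_dot_flip e : partial_dot y n (flip (pred1 i) e) =
  partial_dot y n e.
  apply: eq_bigr => j jn; rewrite sign_vec_flip/= (_ : j == i = false) ?mul1r//.
  by apply/negbTE; rewrite -val_eqE/= ltn_eqF.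
have half (t : R) : t = 2^-1 * (t + t) by lra.
rewrite avgZ [LHS]half; congr (_ * _).
rewrite -{2}(avg_flip (pred1 i)) -avgD; apply: eq_avg => e.
rewrite !partial_dotS partial_dot_flip sign_vec_flip/= eqxx expr1 mulN1r mulNr.
by rewrite /sign_vec; case: (e _);
  rewrite ?expr0 ?expr1 ?mul1r ?mulN1r ?opprK// addrC.
Qed.

(** The odd powers of a new term cancel in the mean over its sign:
    [(t + b)^4] becomes [t^4 + 6 b^2 t^2 + b^4], and [3 (S + b^2)^2] exceeds
    [3 S^2 + 6 b^2 S + b^4]. *)
Let partial_dot_moments y n : (n <= N)%N ->
  avg (fun e => partial_dot y n e ^+ 2) = \sum_(j < N | (j < n)%N) y j ^+ 2 /\
  avg (fun e => partial_dot y n e ^+ 4) <=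
    3 * (\sum_(j < N | (j < n)%N) y j ^+ 2) ^+ 2.
Proof.
elim: n => [_|n IH nN].
  have h0 e : partial_dot y 0 e = 0 by rewrite /partial_dot big_pred0.
  rewrite (eq_avg (G := fun=> 0)); last by move=> e; rewrite h0 expr0n.
  rewrite avg_cst (eq_avg (G := fun=> 0)); last by move=> e; rewrite h0 expr0n.
  by rewrite avg_cst big_pred0// expr0n mulr0.
have [IH2 IH4] := IH (ltnW nN).
have -> : \sum_(j < N | (j < n.+1)%N) y j ^+ 2 =
    \sum_(j < N | (j < n)%N) y j ^+ 2 + y (Ordinal nN) ^+ 2.
  rewrite (bigD1 (Ordinal nN))//= addrC; congr (_ + _).
  by apply: eq_bigl => j; rewrite ltnS -val_eqE/= andbC -ltn_neqAle.
rewrite !(avg_partial_dotS _ nN (fun t => t ^+ _)).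
move: (y (Ordinal nN)) => b; split.
  rewrite (eq_avg (G := fun e => partial_dot y n e ^+ 2 + b ^+ 2));
    last by move=> e; field.
  by rewrite avgD avg_cst IH2.
rewrite (eq_avg (G := fun e => partial_dot y n e ^+ 4 +
   (6 * b ^+ 2 * partial_dot y n e ^+ 2 + b ^+ 4))); last by move=> e; field.
rewrite avgD avgD avgZ avg_cst IH2.
set S := \sum_(_ < N | _) _ in IH4 *.
have b4 : 0 <= b ^+ 4 by rewrite (_ : 4%N = (2 * 2)%N)// exprM sqr_ge0.
rewrite (_ : 3 * _ =
  3 * S ^+ 2 + (6 * b ^+ 2 * S + b ^+ 4) + 2 * b ^+ 4); last by ring.
lra.
Qed.

Lemma avg_dot2 y : avg (fun e => dot (sign_vec e) y ^+ 2) = \sum_j y j ^+ 2.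
Proof.
have [+ _] := partial_dot_moments y (leqnn N).
rewrite /partial_dot (eq_bigl predT); last by move=> j; rewrite /= ltn_ord.
move=> <-; apply: eq_avg => e; congr (_ ^+ _).
by apply: eq_bigl => j; rewrite ltn_ord.
Qed.

Lemma avg_dot4 y :
  avg (fun e => dot (sign_vec e) y ^+ 4) <= 3 * (\sum_j y j ^+ 2) ^+ 2.
Proof.
have [_ +] := partial_dot_moments y (leqnn N).
rewrite [X in _ <= 3 * X ^+ 2 -> _](eq_bigl predT);
  last by move=> j; rewrite /= ltn_ord.
apply: le_trans; rewrite le_eqVlt; apply/orP; left; apply/eqP.
apply: eq_avg => e; congr (_ ^+ _).
by apply: eq_bigl => j; rewrite ltn_ord.
Qed.

(** Khinchine's inequality for the first moment.  It follows from the second and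
    fourth moments: [|t|] lies above the polynomial
    [(12 r^2 t^2 - t^4) / (16 r^3)], which touches it at [|t| = 2 r], and for
    [r] the l_2 norm the mean of that polynomial is at least [9 r / 16]. *)
Lemma khinchine_l1 y : Num.sqrt (\sum_j y j ^+ 2) <= 2 * mean_abs y.
Proof.
set S := \sum_j _; set r := Num.sqrt S.
have S0 : 0 <= S by apply: sumr_ge0 => j _; exact: sqr_ge0.
have r2 : r ^+ 2 = S by rewrite sqr_sqrtr.
have r0 : 0 <= r by exact: sqrtr_ge0.
have [r_eq0|rn0] := eqVneq r 0.
  rewrite r_eq0; apply: mulr_ge0 => //; rewrite -(avg_cst 0).
  by apply: ler_avg => e; exact: normr_ge0.
have rgt0 : 0 < r by rewrite lt0r rn0.
(* 16 r^3 t - 12 r^2 t^2 + t^4 = t (t - 2 r)^2 (t + 4 r) for t >= 0. *)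
have key t : 12 * r ^+ 2 * t ^+ 2 - t ^+ 4 <= 16 * r ^+ 3 * `|t|.
  have <- : `|t| ^+ 2 = t ^+ 2 by rewrite real_normK ?num_real.
  have <- : `|t| ^+ 4 = t ^+ 4.
    by rewrite (_ : 4%N = (2 * 2)%N)// !exprM real_normK ?num_real.
  move: `|t| (normr_ge0 t) => x x0.
  rewrite -subr_ge0 (_ : _ - _ = x * ((x - 2 * r) ^+ 2 * (x + 4 * r)));
    last by ring.
  by apply: mulr_ge0 => //; apply: mulr_ge0; [exact: sqr_ge0 | lra].
have : avg (fun e =>
  12 * r ^+ 2 * dot (sign_vec e) y ^+ 2 - dot (sign_vec e) y ^+ 4)
     <= 16 * r ^+ 3 * mean_abs y.
  by rewrite /mean_abs -avgZ; apply: ler_avg => e; exact: key.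
rewrite avgD avgN avgZ avg_dot2 -/S -r2 => h.
have h4 := avg_dot4 y; rewrite -/S -r2 in h4.
have : 9 * r ^+ 4 <= 16 * r ^+ 3 * mean_abs y.
  apply: le_trans h.
  rewrite (_ : 12 * r ^+ 2 * r ^+ 2 = 12 * r ^+ 4); last by ring.
  rewrite (_ : (r ^+ 2) ^+ 2 = r ^+ 4) in h4; last by ring.
  lra.
rewrite (_ : 9 * r ^+ 4 = r ^+ 3 * (9 * r)); last by ring.
rewrite (_ : 16 * r ^+ 3 * mean_abs y = r ^+ 3 * (16 * mean_abs y));
  last by ring.
rewrite ler_pM2l ?exprn_gt0// => h'.
lra.
Qed.

Section Comparison.
Variables (K : set vec) (u : vec -> R) (G : signs -> R).
Hypothesis uG : forall e y, K y -> u y + 2 * dot (sign_vec e) y <= G e.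

(** Symmetrization and contraction in one step, for one random sign vector and
    one point [y e] of [K] selected for each outcome [e].  Writing the mean
    [mean_abs] as an average over an independent copy [e'], the quantity to
    average is [S e e' = u (y e) + |<e', y e>| - |<e, y e>|].  Since the pair
    [(e, e')] is exchangeable, [S e e'] may be replaced by
    [(S e e' + S e' e) / 2], in which the absolute values regroup, by the
    triangle inequality, into [|<e, y e - y e'>| + |<e', y e - y e'>|].  Each of
    these is controlled by [G] at a sign vector and at its opposite. *)
Lemma avg_selection_le (y : signs -> vec) : (forall e, K (y e)) ->
  avg (fun e => u (y e) + mean_abs (y e) - `|dot (sign_vec e) (y e)|) <= avg G.
Proof.
move=> Ky.
pose S e e' := u (y e) + `|dot (sign_vec e') (y e)| - `|dot (sign_vec e) (y e)|.
have -> : avg (fun e => u (y e) + mean_abs (y e) - `|dot (sign_vec e) (y e)|) =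
    avg (fun e => avg (S e)).
  by apply: eq_avg => e; rewrite /S avgD avgD !avg_cst.
have -> : avg (fun e => avg (S e)) =
    avg (fun e => avg (fun e' => 2^-1 * (S e e' + S e' e))).
  transitivity (2^-1 * (avg (fun e => avg (S e)) + avg (fun e => avg (S^~ e)))).
    by rewrite -avg_exchange; lra.
  by rewrite -avgD -avgZ; apply: eq_avg => e; rewrite avgZ avgD.
pose G2 e := G e + G (flip predT e).
have G2P e y1 y2 : K y1 -> K y2 ->
    u y1 + u y2 + 2 * `|dot (sign_vec e) y1 - dot (sign_vec e) y2| <= G2 e.
  move=> K1 K2; rewrite /G2.
  have := uG e K1; have := uG e K2.
  have := uG (flip predT e) K1; have := uG (flip predT e) K2.
  rewrite !dot_flipT.
  have [_|_] := ger0P (dot (sign_vec e) y1 - dot (sign_vec e) y2); lra.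
have SG e e' : 2^-1 * (S e e' + S e' e) <= 4^-1 * (G2 e + G2 e').
  have := G2P e _ _ (Ky e) (Ky e'); have := G2P e' _ _ (Ky e) (Ky e').
  have := lerB_dist (dot (sign_vec e') (y e)) (dot (sign_vec e') (y e')).
  have := lerB_dist (dot (sign_vec e) (y e')) (dot (sign_vec e) (y e)).
  rewrite (distrC (dot (sign_vec e) (y e'))) /S; lra.
apply: (@le_trans _ _ (avg (fun e => avg (fun e' => 4^-1 * (G2 e + G2 e'))))).
  by apply: ler_avg => e; exact: ler_avg.
have avgG2 : avg G2 = 2 * avg G by rewrite avgD avg_flip; lra.
under eq_avg => e do rewrite avgZ avgD avg_cst.
by rewrite avgZ avgD avg_cst avgG2; lra.
Qed.

(** The selection bound becomes a bound on the average of a supremum by taking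
    [H e] to be the supremum over [K] and selecting almost maximal points. *)
Lemma avg_comparison : K !=set0 ->
  exists2 H : signs -> R,
    (forall e y, K y -> u y + mean_abs y - `|dot (sign_vec e) y| <= H e) &
    avg H <= avg G.
Proof.
move=> [y0 Ky0].
pose A e := [set u y + mean_abs y - `|dot (sign_vec e) y| | y in K].
have ubA e : has_ubound (A e).
  exists (avg (fun e => `|G e| + `|G (flip predT e)|)) => _ [y Ky <-].
  apply: (@le_trans _ _ (u y + mean_abs y)); first by rewrite lerBlDr lerDl.
  rewrite -[u y]avg_cst -avgD; apply: ler_avg => e'.
  have := uG e' Ky; have := uG (flip predT e') Ky.
  rewrite dot_flipT; have := ler_norm (G e');
    have := ler_norm (G (flip predT e')).
  have := normr_ge0 (G e'); have := normr_ge0 (G (flip predT e')).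
  by have [_|_] := ger0P (dot (sign_vec e') y); lra.
have supA e : has_sup (A e).
  by split=> //; exists (u y0 + mean_abs y0 - `|dot (sign_vec e) y0|); exists y0.
exists (fun e => sup (A e)).
  by move=> e y Ky; apply: ub_le_sup => //; exists y.
apply/ler_addgt0Pr => d d0.
have near e : exists y, K y /\ sup (A e) <=
  u y + mean_abs y - `|dot (sign_vec e) y| + d.
  have [_ [y Ky <-] h] := sup_adherent d0 (supA e).
  by exists y; split=> //; rewrite -lerBlDr ltW.
have [y yP] := choice near.
apply: le_trans (lerD (avg_selection_le (fun e => (yP e).1)) (lexx d)).
rewrite -[X in _ + X]avg_cst -avgD; apply: ler_avg => e; exact: (yP e).2.
Qed.

End Comparison.

(** Averaging over one step of the random walk with sign-vector increments;
    its [k]-fold iterate is the expectation after [k] steps. *)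
Definition shift_avg (G : vec -> R) : vec -> R :=
  fun s => avg (fun e => G (s + sign_vec e)).

Lemma ler_iter_shift_avg k F G s : (forall s, F s <= G s) ->
  iter k shift_avg F s <= iter k shift_avg G s.
Proof.
by move=> FG; elim: k s => [|k IH] s //=; apply: ler_avg => e; exact: IH.
Qed.

Lemma iter_shift_avg_avg k (F : signs -> vec -> R) s :
  iter k shift_avg (fun s => avg (F^~ s)) s =
  avg (fun e => iter k shift_avg (F e) s).
Proof.
elim: k s => [//|k IH] s /=.
by rewrite {1}/shift_avg avg_exchange; apply: eq_avg => e; rewrite IH.
Qed.

(** The one-vector comparison is iterated.  The function [u] ranges over
    arbitrary functions on [K], so the vectors can be exchanged one at a time.
    For each value [s] of the sum of the other vectors the comparison is applied
    to [u y + 2 * dot s y]; then a value [e] of the new vector is fixed that is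
    good on average over [s], and [mean_abs y - |dot (sign_vec e) y|] is added to
    [u].  Since [e] must not depend on [s], the comparison has to bound a whole
    function [H s] of the sign vector and not only one favourable outcome. *)
Lemma exists_sign_vectors (K : set vec) k (u : vec -> R) (G : vec -> R) : K !=set0 ->
  (forall s y, K y -> u y + 2 * dot s y <= G s) ->
  exists es : nat -> signs, forall y, K y ->
    u y + k%:R * mean_abs y - \sum_(i < k) `|dot (sign_vec (es i)) y| <=
    iter k shift_avg G 0.
Proof.
move=> K0; elim: k u G => [|k IH] u G uG.
  exists (fun=> [ffun=> false]) => y Ky.
  by have := uG 0 y Ky; rewrite dot0l mulr0 addr0 mul0r addr0 big_ord0 subr0.
have step s : exists H : signs -> R,
    (forall e y, K y -> u y + 2 * dot s y + mean_abs y - `|dot (sign_vec e) y| <= H e) /\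
    avg H <= shift_avg G s.
  have [|H ? ?] := @avg_comparison K (fun y => u y + 2 * dot s y)
    (fun e => G (s + sign_vec e)) _ K0; last by exists H.
  move=> e y Ky; apply: le_trans (uG (s + sign_vec e) y Ky).
  by rewrite dotDl mulrDr addrA.
have [H HP] := choice step.
have [e eP] := exists_le_avg (fun e => iter k shift_avg (H^~ e) 0).
have [|es esP] := IH (fun y =>
  u y + mean_abs y - `|dot (sign_vec e) y|) (H^~ e).
  by move=> s y Ky; have := (HP s).1 e y Ky; lra.
exists (fun i => if i is i'.+1 then es i' else e) => y Ky.
rewrite big_ord_recl/= -[k.+1]addn1 natrD mulrDl mul1r.
have := esP y Ky.
have : iter k shift_avg (H^~ e) 0 <= iter k.+1 shift_avg G 0.
  apply: (le_trans eP); rewrite -iter_shift_avg_avg iterSr.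
  by apply: ler_iter_shift_avg => s; exact: (HP s).2.
move=> /[swap] h1 /(le_trans h1); apply: le_trans.
rewrite [X in _ - (_ + X)](_ : _ =
  \sum_(i < k) `|dot (sign_vec (es i)) y|)//; lra.
Qed.

Definition cosh (l : R) : R := 2^-1 * (expR l + expR (- l)).

(** The majorants used for the dual norms below.  They are chosen because each
    summand is an eigenfunction of [shift_avg]. *)
Definition exp_sum (w l : vec) (s : vec) : R :=
  \sum_j w j * (expR (l j * s j) + expR (- (l j * s j))).

Lemma shift_avg_exp_sum w l s :
  shift_avg (exp_sum w l) s = exp_sum (fun j => w j * cosh (l j)) l s.
Proof.
rewrite /shift_avg /exp_sum avg_sum; apply: eq_bigr => j _.
have half (t : R) : t = 2^-1 * (t + t) by lra.
rewrite avgZ -mulrA; congr (_ * _).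
rewrite [LHS]half -{2}(avg_flip (pred1 j)) -avgD -avgZ -[RHS]avg_cst.
apply: eq_avg => e; rewrite !fctE sign_vec_flip/= eqxx expr1 mulN1r /cosh.
have -> : expR (l j * (s j + sign_vec e j)) + expR (- (l j * (s j + sign_vec e j))) +
    (expR (l j * (s j + - sign_vec e j)) + expR (- (l j * (s j + - sign_vec e j)))) =
    (expR (l j) + expR (- l j)) * (expR (l j * s j) + expR (- (l j * s j))).
  have E (t : R) : l j * (s j + t) = l j * s j + l j * t by rewrite mulrDr.
  rewrite !E /sign_vec; case: (e j);
    rewrite /= ?expr1 ?expr0 ?opprK ?mulr1 ?mulrN1 !opprD ?opprK !expRD; ring.
by rewrite mulrA.
Qed.

Lemma iter_shift_avg_exp_sum k c w l s :
  iter k shift_avg (fun s => c + exp_sum w l s) s =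
  c + exp_sum (fun j => w j * cosh (l j) ^+ k) l s.
Proof.
elim: k w s => [|k IH] w s.
  by rewrite /= /exp_sum; congr (_ + _); apply: eq_bigr => j _;
    rewrite expr0 mulr1.
rewrite iterSr.
have -> : shift_avg (fun s => c + exp_sum w l s) =
    fun s => c + exp_sum (fun j => w j * cosh (l j)) l s.
  by apply/funext => t; rewrite {1}/shift_avg avgD avg_cst -shift_avg_exp_sum.
rewrite IH; congr (_ + _); apply: eq_bigr => j _.
by rewrite exprS mulrA.
Qed.

(** The constant 2 in place of the optimal 1/2 allows an elementary proof: for
    [x >= 1/2], [cosh x <= exp x <= exp (2 x^2)], and for smaller [x] the
    bounds [exp x <= 1 / (1 - x)] and [exp (- x) <= 1 / (1 + x)] give
    [cosh x <= 1 / (1 - x^2) <= 1 + 2 x^2]. *)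
Lemma cosh_le (x : R) : cosh x <= expR (2 * x ^+ 2).
Proof.
wlog x0 : x / 0 <= x.
  move=> h; have [/h//|/ltW x0] := leP 0 x.
  by have := h (- x); rewrite oppr_ge0 => /(_ x0);
    rewrite sqrrN /cosh opprK addrC.
have [x1|x1] := leP (2^-1) x.
  apply: (@le_trans _ _ (expR x)).
    have : expR (- x) <= expR x by rewrite ler_expR; lra.
    by rewrite /cosh; lra.
  by rewrite ler_expR expr2; nra.
apply: le_trans (expR_ge1Dx _).
have : expR x * (1 - x) <= 1.
  by rewrite -[leRHS](expRxMexpNx_1 x) ler_pM2l ?expR_gt0// expR_ge1Dx.
have : expR (- x) * (1 + x) <= 1.
  by rewrite -[leRHS](expRxMexpNx_1 x) mulrC ler_pM2r ?expR_gt0// expR_ge1Dx.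
rewrite /cosh; move: (expR x) (expR (- x)) => a b hb ha.
have : a <= (1 - x)^-1 by rewrite -[_^-1]mul1r ler_pdivlMr//; lra.
have : b <= (1 + x)^-1 by rewrite -[_^-1]mul1r ler_pdivlMr//; lra.
have : (1 - x)^-1 + (1 + x)^-1 <= 2 + 4 * x ^+ 2; last by lra.
have -> : (1 - x)^-1 + (1 + x)^-1 = 2 / (1 - x ^+ 2).
  have e1 : 1 - x != 0 by rewrite gt_eqF//; lra.
  have e2 : 1 + x != 0 by rewrite gt_eqF//; lra.
  have e3 : 1 - x ^+ 2 != 0 by rewrite gt_eqF// expr2; nra.
  by field; apply/and3P; split.
have x2 : 0 <= x ^+ 2 <= 4^-1 by rewrite expr2; nra.
rewrite ler_pdivrMr; nra.
Qed.

(** On the common kernel of the sign vectors the sum of the [|<e_i, y>|]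
    vanishes, so the comparison bounds [m * mean_abs y], hence [m] times the l_2
    norm of [y], by the expectation of the majorant after [m] steps. *)
Lemma kernel_norm_le (K : set vec) m c (w l : vec) : K !=set0 ->
  (forall j, 0 <= w j) ->
  (forall s y, K y -> 2 * dot s y <= c + exp_sum w l s) ->
  exists es : nat -> signs, forall y, K y ->
    (forall i, (i < m)%N -> dot (sign_vec (es i)) y = 0) ->
    m%:R * Num.sqrt (\sum_j y j ^+ 2) <=
      2 * (c + 2 * \sum_j w j * expR (2 * m%:R * l j ^+ 2)).
Proof.
move=> K0 w0 Kw.
have [|es esP] := @exists_sign_vectors K m (fun=> 0) (fun s =>
  c + exp_sum w l s) K0.
  by move=> s y Ky; rewrite add0r; exact: Kw.
exists es => y Ky ker; have := esP y Ky.
rewrite big1 ?subr0 ?add0r; last by move=> i _; rewrite ker// normr0.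
rewrite iter_shift_avg_exp_sum => h.
have : m%:R * Num.sqrt (\sum_j y j ^+ 2) <= m%:R * (2 * mean_abs y).
  by rewrite ler_wpM2l// khinchine_l1.
have : exp_sum (fun j => w j * cosh (l j) ^+ m) l 0 <=
    2 * \sum_j w j * expR (2 * m%:R * l j ^+ 2).
  rewrite mulr_sumr; apply: ler_sum => j _.
  rewrite mulr0 oppr0 expR0 mulrC mulr_natl -mulr_natl ler_wpM2l//.
  rewrite ler_wpM2l// (_ : 2 * _ * _ = m%:R * (2 * l j ^+ 2)); last by ring.
  rewrite expRM_natl lerXn2r ?nnegrE ?expR_ge0 ?cosh_le//.
  by rewrite mulr_ge0// addr_ge0 ?expR_ge0.
lra.
Qed.

End SignAverages.

(** * Sequence norms as bounds on finite sums *)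
Section EllpFacts.
Variable R : realType.
Implicit Types (p : \bar R) (x y : nat -> R).

(** Only the empty set is null for the counting measure. *)
Lemma counting_aeP (P : nat -> Prop) :
  (\forall i \ae @counting nat R, P i) -> forall i, P i.
Proof.
move=> [A [mA A0 PA]] i; apply: contrapT => Pi.
have Ai : A i by exact: PA.
move: A0; rewrite /counting; case: asboolP => [fA /eqP|//].
rewrite eqe pnatr_eq0 cardfs_eq0 => /eqP /(congr1 (fun B => i \in B)).
by rewrite in_fset_set// inE mem_set.
Qed.

(** Both this lemma and the next one replace the norm by elementary conditions,
    so that no integral or essential supremum occurs in the estimates. *)
Lemma ellp_norm_le_real (r : R) x (b : R) : 0 < r -> 0 <= b ->
  (ellp_norm r%:E x <= b%:E)%E <->
  forall n, \sum_(j < n) `|x j| `^ r <= b `^ r.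
Proof.
move=> r0 b0; rewrite /ellp_norm Lnorm_counting//=.
have h k : (0 <= (`|x k| `^ r)%:E)%E by rewrite lee_fin powR_ge0.
set S := (\sum_(_ <= _ <oo) _)%E.
have S0 : (0 <= S)%E by exact: nneseries_ge0.
have -> : (S `^ r^-1 <= b%:E)%E <-> (S <= (b `^ r)%:E)%E.
  split=> H.
    have : ((S `^ r^-1) `^ r <= b%:E `^ r)%E.
      by apply: gt0_ler_poweR;
        rewrite ?(ltW r0)// in_itv/= ?poweR_ge0 ?leey ?lee_fin ?b0.
    by rewrite -poweRrM mulVf ?gt_eqF// poweRe1// poweR_EFin.
  have : (S `^ r^-1 <= (b `^ r)%:E `^ r^-1)%E.
    by apply: gt0_ler_poweR;
      rewrite ?invr_ge0 ?(ltW r0)// in_itv/= ?S0 ?leey ?lee_fin ?powR_ge0.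
  by rewrite poweR_EFin -powRrM divff ?gt_eqF// powRr1.
split=> [H n|H].
  rewrite -lee_fin; apply: le_trans H.
  rewrite -sumEFin -(big_mkord xpredT (fun j => (`|x j| `^ r)%:E)).
  by apply: nneseries_lim_ge => k _ _.
apply: lime_le; first by apply: is_cvg_nneseries.
near=> n; rewrite big_mkord sumEFin lee_fin; exact: H.
Unshelve. all: by end_near. Qed.

Lemma ellp_norm_le_oo x (b : R) :
  (ellp_norm +oo%E x <= b%:E)%E <-> forall j, `|x j| <= b.
Proof.
have c0 : (0 < @counting nat R [set: nat])%E.
  by rewrite /counting asboolF//; exact: infinite_nat.
rewrite /ellp_norm unlock c0; split.
  by move=> /ess_supP /counting_aeP h j; rewrite -lee_fin; exact: h.
by move=> h; apply: ess_sup_ler => t /=; rewrite lee_fin.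
Qed.

Lemma ellp_norm_ge0 p x : (0 <= ellp_norm p x)%E.
Proof. exact: Lnorm_ge0. Qed.

Lemma ellp_norm0 p : (1 <= p)%E -> ellp_norm p (0 : nat -> R) = 0%E.
Proof.
by move=> p1; rewrite /ellp_norm; apply: Lnorm0;
  rewrite gt_eqF// (lt_le_trans lte01).
Qed.

Lemma coord_le_ellp_norm p x j : (1 <= p)%E -> (`|x j|%:E <= ellp_norm p x)%E.
Proof.
move=> p1; have [->|] := eqVneq (ellp_norm p x) +oo%E; first by rewrite leey.
rewrite -ltey => nfin.
have [b [b0 nb]] : exists b : R, 0 <= b /\ ellp_norm p x = b%:E.
  exists (fine (ellp_norm p x)); rewrite fine_ge0 ?ellp_norm_ge0// fineK//.
  by rewrite ge0_fin_numE ?ellp_norm_ge0.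
rewrite nb; have : (ellp_norm p x <= b%:E)%E by rewrite nb.
case: p p1 {nfin nb} => [r||//] p1; last first.
  by move=> /ellp_norm_le_oo; rewrite lee_fin; exact.
have r0 : 0 < r by rewrite (lt_le_trans ltr01).
move=> /(ellp_norm_le_real _ r0 b0) /(_ j.+1).
rewrite big_ord_recr/= => h.
have : `|x j| `^ r <= b `^ r.
  by apply: le_trans h; rewrite lerDr sumr_ge0// => i _; exact: powR_ge0.
rewrite lee_fin leNgt => h'; rewrite leNgt; apply: contra h' => h'.
by rewrite gt0_ltr_powR// nnegrE.
Qed.

Lemma ellp_submod p (a : R) x y : (1 <= p)%E ->
  ellp p x -> ellp p y -> ellp p (a *: x + y).
Proof.
move=> p1 hx hy.
have h z : ellp p z <-> z \in Lfun (@counting nat R) p.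
  split=> [hz|/andP[_ /set_mem]//].
  by apply/andP; split; apply/mem_set.
apply/h; apply: (Lfun_submod_closed _ p1).2; exact/h.
Qed.

Lemma ellp_finite_support p x M : (1 <= p)%E ->
  (forall j, (M <= j)%N -> x j = 0) -> ellp p x.
Proof.
move=> p1 x0; rewrite /ellp/=.
pose b := \sum_(j < M) `|x j|.
have b0 : 0 <= b by apply: sumr_ge0.
case: p p1 => [r||//] p1; last first.
  rewrite (@le_lt_trans _ _ b%:E) ?ltry//; apply/ellp_norm_le_oo => j.
  have [jM|/x0->] := ltnP j M; last by rewrite normr0.
  by rewrite /b (bigD1 (Ordinal jM))//= lerDl sumr_ge0.
have r0 : 0 < r by rewrite (lt_le_trans ltr01).
pose S := \sum_(j < M) `|x j| `^ r.
have S0 : 0 <= S by apply: sumr_ge0 => j _; exact: powR_ge0.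
rewrite (@le_lt_trans _ _ (S `^ r^-1)%:E) ?ltry//.
apply/ellp_norm_le_real; rewrite ?powR_ge0// => n.
rewrite -powRrM mulVf ?gt_eqF// powRr1//.
rewrite /S -!(big_mkord xpredT (fun j => `|x j| `^ r)).
have [nM|Mn] := leqP n M.
  by rewrite (big_cat_nat (n := n) (p := M))//= lerDl sumr_ge0// =>
    j _; exact: powR_ge0.
rewrite (big_cat_nat (n := M) (p := n))//=; last exact: ltnW.
rewrite gerDl big_nat_cond big1// => j /andP[/andP[Mj _] _].
by rewrite x0// normr0 powR0// gt_eqF.
Qed.

Lemma ellp_norm2_le y (b : R) : 0 <= b ->
  (forall n, \sum_(j < n) y j ^+ 2 <= b ^+ 2) -> (ellp_norm 2%:E y <= b%:E)%E.
Proof.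
move=> b0 h; apply/ellp_norm_le_real => // n.
rewrite powR_mulrn//; apply: le_trans (h n).
by apply: ler_sum => j _; rewrite powR_mulrn// real_normK ?num_real.
Qed.

(** Young's inequality, summed over the coordinates.  It serves instead of
    Hoelder's inequality because its right-hand side is affine in the [q]-th
    powers of the weights: its expectation for random weights can be computed
    without Jensen's inequality.  For [p = +oo] one has [q = 1] and the constant
    term disappears. *)
Lemma young_ball p q (x a : nat -> R) (L : R) n : (1 < p)%E ->
  hoelder_conjugate p = q%:E -> (ellp_norm p x <= 1)%E ->
  (forall j, 0 <= a j) -> 0 < L ->
  \sum_(j < n) a j * `|x j| <=
  L * (1 - q^-1 + q^-1 * \sum_(j < n) (a j / L) `^ q).
Proof.
move=> p1 pq x1 a0 L0.
have aL j : 0 <= a j / L by rewrite divr_ge0// ltW.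
have -> : \sum_(j < n) a j * `|x j| = L * \sum_(j < n) `|x j| * (a j / L).
  by rewrite mulr_sumr; apply: eq_bigr => j _; field; rewrite gt_eqF.
rewrite ler_wpM2l ?(ltW L0)//.
case: p p1 pq x1 => [r||//] p1 pq x1; last first.
  move: pq => [] <-; rewrite invr1 subrr add0r mul1r; apply: ler_sum => j _.
  rewrite powRr1// ler_piMl//; move: j => [j _] /=.
  by move/ellp_norm_le_oo: x1; exact.
have r1 : 1 < r by [].
have r0 : 0 < r by rewrite (lt_trans ltr01).
have q0 : 0 < q.
  by rewrite -lte_fin -pq (lt_le_trans lte01)// hoelder_conj_ge1// ltW.
have rq : r^-1 + q^-1 = 1.
  apply: EFin_inj; rewrite -(@hoelder_conjugate_eq1 R r%:E) ?ltNyr ?gt_eqF//.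
  by rewrite pq EFinD !inver !gt_eqF.
apply: (@le_trans _ _ (\sum_(j < n) (`|x j| `^ r / r + (a j / L) `^ q / q))).
  by apply: ler_sum => j _; exact: conjugate_powR.
rewrite big_split/= -!mulr_suml [_ * q^-1]mulrC lerD2r -rq addrK.
rewrite ler_piMl ?invr_ge0 ?(ltW r0)//.
have := (ellp_norm_le_real x r0 ler01).1 x1 n.
by rewrite powR1.
Qed.

End EllpFacts.

(** * Gelfand numbers and kernels of finitely many functionals *)
Section Gelfand.
Variable R : realType.
Implicit Types (p q : \bar R) (x y : nat -> R).

Definition initial M x : 'rV[R]_M := \row_(j < M) x j.

(** The subspaces that compete in the infimum: common kernels of [d]
    functionals (the columns of [B]) that depend on the first [M] coordinates
    only. *)
Definition initial_ker p M d (B : 'M[R]_(M, d)) : set (nat -> R) :=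
  [set x | ellp p x /\ initial M x *m B = 0].

Lemma initial_linear M (a : R) x y : initial M (a *: x + y) =
  a *: initial M x + initial M y.
Proof. by apply/rowP => j; rewrite !mxE. Qed.

Lemma closed_initial_ker p M d (B : 'M[R]_(M, d)) : (1 <= p)%E ->
  closed_subspace p (initial_ker p B).
Proof.
move=> p1; split.
- by move=> x [].
- split; first by apply: (ellp_finite_support (M := 0)).
  by rewrite (_ : initial M 0 = 0) ?mul0mx//; apply/rowP => j; rewrite !mxE.
- move=> a x y [x1 x2] [y1 y2]; split; first exact: ellp_submod.
  by rewrite initial_linear mulmxDl -scalemxAl x2 y2 scaler0 addr0.
move=> x xp xE; split=> //; apply/rowP => i; rewrite [RHS]mxE.
apply/eqP; rewrite -normr_le0.
pose b := \sum_(j < M) `|B j i|.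
have b0 : 0 <= b by exact: sumr_ge0.
apply/ler_addgt0Pr => e e0; rewrite add0r.
have b1 : 0 < b + 1 by lra.
have [y [_ y2] xy] := xE (e / (b + 1)) (divr_gt0 e0 b1).
have -> : (initial M x *m B) 0 i = \sum_(j < M) (x j - y j) * B j i.
  move/rowP : y2 => /(_ i); rewrite [RHS]mxE => y2.
  transitivity ((initial M x *m B) 0 i - (initial M y *m B) 0 i);
    first by rewrite y2 subr0.
  rewrite !mxE -sumrB; apply: eq_bigr => j _.
  by rewrite !mxE mulrBl.
apply: (le_trans (ler_norm_sum _ _ _)).
apply: (@le_trans _ _ (\sum_(j < M) e / (b + 1) * `|B j i|)).
  apply: ler_sum => j _; rewrite normrM ler_wpM2r//.
  rewrite -lee_fin; apply: (le_trans _ (ltW xy)).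
  exact: (@coord_le_ellp_norm _ p (x - y) j p1).
rewrite -mulr_sumr -/b mulrAC ler_pdivrMr//; nra.
Qed.

(** The rows of the partial inverse of [B], extended by zero, span the quotient:
    [z = (x B) B^-] satisfies [z B = x B]. *)
Lemma codim_initial_ker p M d (B : 'M[R]_(M, d)) : (1 <= p)%E ->
  codim_le p (initial_ker p B) d.
Proof.
move=> p1.
pose v (i : 'I_d) : nat -> R :=
  fun j => if insub j is Some j' then pinvmx B i j' else 0.
have vp i : ellp p (v i).
  apply: (ellp_finite_support (M := M)) => // j Mj.
  by rewrite /v insubF// ltnNge Mj.
exists v => // x xp; exists (fun i => (initial M x *m B) 0 i).
set c := (initial M x *m B).
have initial_sum : initial M (\sum_(i < d) c 0 i *: v i) = c *m pinvmx B.
  apply/rowP => j; rewrite !mxE fct_sumE; apply: eq_bigr => i _.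
  by rewrite /v [LHS]/= /GRing.scale/= valK.
have xBE : x - \sum_(i < d) c 0 i *: v i =
  (-1 : R) *: (\sum_(i < d) c 0 i *: v i) + x.
  by rewrite scaleN1r addrC.
rewrite xBE; split.
  apply: ellp_submod => //; elim/big_ind : _ => //.
  - by apply: (ellp_finite_support (M := 0)).
  - by move=> y z yp zp; rewrite -[y]scale1r; exact: ellp_submod.
  - move=> i _; rewrite -[_ *: _]addr0; apply: ellp_submod => //.
    by apply: (ellp_finite_support (M := 0)).
rewrite initial_linear initial_sum mulmxDl -scalemxAl mulmxKpV ?submxMl//.
by rewrite scaleN1r addNr.
Qed.

Lemma gelfand_le_initial_ker p q (T : (nat -> R) -> (nat -> R)) n M
    (B : 'M[R]_(M, n.-1)) (beta : \bar R) : (1 <= p)%E ->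
  (forall x, (ellp_norm p x <= 1)%E -> initial M x *m B = 0 ->
    (ellp_norm q (T x) <= beta)%E) ->
  (gelfand_number p q T n <= beta)%E.
Proof.
move=> p1 h.
apply: (@le_trans _ _ (ereal_sup [set ellp_norm q (T x) | x in
    [set x | initial_ker p B x /\ (ellp_norm p x <= 1)%E]])).
  apply: ereal_inf_lbound; exists (initial_ker p B) => //; split.
    exact: closed_initial_ker.
  exact: codim_initial_ker.
by apply: ge_ereal_sup => _ [x [[_ xB] x1] <-]; exact: h.
Qed.

Lemma gelfand_ge0 p q (T : (nat -> R) -> (nat -> R)) n : (1 <= p)%E ->
  (0 <= gelfand_number p q T n)%E.
Proof.
move=> p1; apply: le_ereal_inf_tmp => _ [E [[_ E0 _ _] _] <-].
apply: le_trans (ereal_sup_ubound _); last first.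
  by exists 0 => //; split=> //; rewrite ellp_norm0.
exact: ellp_norm_ge0.
Qed.

(** The tail is measured by the larger l_1 norm, for which the bounds on the
    unit ball are direct. *)
Lemma ellp_norm2_split y M (b t : R) : 0 <= b -> 0 <= t ->
  Num.sqrt (\sum_(j < M) y j ^+ 2) <= b ->
  (forall n, \sum_(M <= j < n) `|y j| <= t) ->
  (ellp_norm 2%:E y <= (b + t)%:E)%E.
Proof.
move=> b0 t0 hb ht; apply: ellp_norm2_le => [|n]; first exact: addr_ge0.
have hb2 : \sum_(j < M) y j ^+ 2 <= b ^+ 2.
  have S0 : 0 <=
    \sum_(j < M) y j ^+ 2 by apply: sumr_ge0 => j _; exact: sqr_ge0.
  by rewrite -(sqr_sqrtr S0) lerXn2r// nnegrE// sqrtr_ge0.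
have sq n' : \sum_(M <= j < n') y j ^+ 2 <= t ^+ 2.
  apply: (@le_trans _ _ ((\sum_(M <= j < n') `|y j|) ^+ 2)); last first.
    by rewrite lerXn2r// nnegrE// sumr_ge0.
  rewrite [leRHS]expr2 mulr_sumr; apply: ler_sum_nat => j /andP[Mj jn].
  rewrite -real_normK ?num_real// expr2 ler_wpM2r//.
  rewrite (bigD1_seq j) ?mem_index_iota ?Mj ?iota_uniq//= lerDl.
  by apply: sumr_ge0.
apply: (@le_trans _ _ (b ^+ 2 + t ^+ 2)); last by nra.
rewrite -!(big_mkord xpredT (fun j => y j ^+ 2)) in hb2 *.
have [nM|Mn] := leqP n M.
  apply: (@le_trans _ _ (b ^+ 2)); last by rewrite lerDl sqr_ge0.
  apply: le_trans hb2; rewrite [leRHS](big_cat_nat (n := n))//= lerDl.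
  by apply: sumr_ge0 => j _; exact: sqr_ge0.
by rewrite (big_cat_nat (n := M)) ?(ltnW Mn)//= lerD.
Qed.

Lemma gelfand_diag_tail p (sigma : nat -> R) n (t : R) : (1 <= p)%E ->
  (forall x, (ellp_norm p x <= 1)%E ->
     forall n, \sum_(0 <= j < n) `|sigma j * x j| <= t) ->
  (gelfand_number p 2%:E (diag_op sigma) n <= t%:E)%E.
Proof.
move=> p1 h.
apply: (@gelfand_le_initial_ker p _ _ n 0 0) => // x x1 _.
have t0 : 0 <= t by have := h x x1 0; rewrite big_geq.
rewrite -[t]add0r; apply: (@ellp_norm2_split _ 0) => //.
  by rewrite big_ord0 sqrtr0.
exact: h.
Qed.

(** The functionals are the first [k0] coordinates and [m] sign vectors applied
    to [sigma x] on the window [0, M).  The coordinates beyond [M] are left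
    alone: their contribution [t] is small when [M] is large. *)
Lemma gelfand_diag_window p (sigma : nat -> R) n k0 m M c (w l : 'I_M -> R) (t : R) :
  (1 <= p)%E -> (k0 + m <= n.-1)%N -> (0 < m)%N ->
  (forall j, 0 <= w j) ->
  (forall x, (ellp_norm p x <= 1)%E -> (forall j, (j < k0)%N -> x j = 0) ->
     (forall s : 'I_M -> R,
       2 * dot s (fun j => sigma j * x j) <= c + exp_sum w l s) /\
     forall n, \sum_(M <= j < n) `|sigma j * x j| <= t) ->
  (k0 <= M)%N ->
  (gelfand_number p 2%:E (diag_op sigma) n <=
    (2 * (c + 2 * \sum_j w j * expR (2 * m%:R * l j ^+ 2)) / m%:R + t)%:E)%E.
Proof.
move=> p1 kmn m0 w0 hx k0M.
pose K : set ('I_M -> R) := [set y | exists x, [/\ (ellp_norm p x <= 1)%E,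
  (forall j, (j < k0)%N -> x j = 0) & y = (fun j : 'I_M => sigma j * x j)]].
have norm0 : (ellp_norm p (0%R : nat -> R) <=
  (1 : R)%:E)%E by rewrite ellp_norm0.
have K0 : K !=set0 by exists (fun j : 'I_M => sigma j * 0); exists 0; split.
have Kw s (y : 'I_M -> R) : K y -> 2 * dot s y <= c + exp_sum w l s.
  by move=> [x [x1 x2 ->]]; exact: (hx x x1 x2).1.
have [es esP] := kernel_norm_le m K0 w0 Kw.
pose B : 'M[R]_(M, n.-1) := \matrix_(j, i)
  if (i < k0)%N then (val j == val i)%:R
  else if (i < k0 + m)%N then sign_vec R (es (i - k0)%N) j * sigma j else 0.
apply: (gelfand_le_initial_ker (B := B)) => // x x1 xB.
have x2 j : (j < k0)%N -> x j = 0.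
  move=> jk0; have jn : (j < n.-1)%N by apply: leq_trans kmn; rewrite ltn_addr.
  have jM : (j < M)%N by apply: leq_trans k0M.
  move/rowP : xB => /(_ (Ordinal jn)); rewrite !mxE.
  rewrite (bigD1 (Ordinal jM))//= !mxE jk0 eqxx mulr1 big1 ?addr0// => i ij.
  rewrite !mxE/= jk0 (_ : (_ == _) = false) ?mulr0//.
  by apply/negbTE; move: ij; rewrite -val_eqE.
have ker i : (i < m)%N -> dot (sign_vec R (es i)) (fun j => sigma j * x j) = 0.
  move=> im; have jn : (k0 + i < n.-1)%N.
    by apply: leq_trans kmn; rewrite ltn_add2l.
  move/rowP : xB => /(_ (Ordinal jn)); rewrite !mxE => xB.
  rewrite -[RHS]xB; apply: eq_bigr => j _.
  rewrite !mxE/= ltnNge leq_addr/= ltn_add2l im addKn; ring.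
have mR : 0 < m%:R :> R by rewrite ltr0n.
have Kx : K (fun j : 'I_M => sigma j * x j) by exists x.
have h := esP _ Kx ker.
have [_ ht] := hx x x1 x2.
have t0 : 0 <= t by have := ht 0; rewrite big_geq.
apply: (@ellp_norm2_split _ M) => //.
  by rewrite divr_ge0 ?ler0n// (le_trans _ h)// mulr_ge0 ?sqrtr_ge0.
by rewrite ler_pdivlMr// mulrC.
Qed.

End Gelfand.

(** * Splitting the codimension *)
Section Bounds.
Variable R : realType.
Implicit Types (p : \bar R) (x y : nat -> R).

(** At most a quarter of the codimension is spent on the initial coordinates,
    which leaves at least [n / 4] sign vectors.  For [n = 1] no functional is
    available, and that case is treated apart. *)
Lemma split_codimension (n : nat) (k : R) : (1 < n)%N -> 0 < k -> k <=
  n%:R / 4 ->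
  exists k0 m : nat, [/\ (k0 + m <= n.-1)%N, (0 < m)%N, n%:R <= 4 * m%:R :> R &
    forall j, (k0 <= j)%N -> k <= j.+1%:R].
Proof.
move=> n1 k_gt0 kn.
have [tk1 tk2] : (Num.truncn k)%:R <= k /\ k < (Num.truncn k).+1%:R.
  by have /andP[] := truncn_itv (ltW k_gt0).
have h : (4 * Num.truncn k <= n)%N.
  by rewrite -(ler_nat R) natrM; lra.
exists (Num.truncn k), (n.-1 - Num.truncn k)%N; split; [lia|lia| |].
  rewrite -[4]/(4%:R) -natrM ler_nat; lia.
by move=> j kj; apply: (le_trans (ltW tk2)); rewrite ler_nat.
Qed.

Lemma sqrt_codim (n m : nat) : (0 < m)%N -> n%:R <= 4 * m%:R :> R ->
  Num.sqrt n%:R <= 2 * Num.sqrt m%:R :> R.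
Proof.
move=> m0 nm; apply: le_trans (ler_wsqrtr nm) _.
rewrite sqrtrM// (_ : 4 = 2 ^+ 2); last by rewrite expr2 -natrM.
by rewrite sqrtr_sqr ger0_norm.
Qed.

Lemma window_tail_le (n m : nat) (P W B : R) : (0 < n)%N -> (0 < m)%N ->
  n%:R <= 4 * m%:R :> R -> 0 <= B -> P <= B * (Num.sqrt m%:R) * W -> 0 <= W ->
  2 * P / m%:R + W / Num.sqrt n%:R <= (4 * B + 1) / Num.sqrt n%:R * W.
Proof.
move=> n0 m0 nm B0 PB W0.
have sm : 0 < Num.sqrt m%:R :> R by rewrite sqrtr_gt0 ltr0n.
have sn : 0 < Num.sqrt n%:R :> R by rewrite sqrtr_gt0 ltr0n.
have nm2 := sqrt_codim m0 nm.
have := sqr_sqrtr (ler0n R m).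
move: (Num.sqrt m%:R) (Num.sqrt n%:R) sm sn nm2 PB => a b a0 b0 ba PB <-.
have BW : 0 <= B * W by exact: mulr_ge0.
rewrite (_ : _ / b * W = 4 * (B * W) / b + W / b);
  last by field; rewrite gt_eqF.
rewrite lerD2r; apply: (@le_trans _ _ (2 * (B * W) / a)).
  rewrite ler_pdivrMr ?exprn_gt0// (_ : _ * a ^+ 2 = 2 * (B * a * W)).
    by rewrite ler_wpM2l.
  by field; rewrite gt_eqF.
rewrite ler_pdivrMr// mulrAC ler_pdivlMr//; nra.
Qed.

(** * The case p > 1 *)
Section PGt1.
Variables (p : \bar R) (q : R).
Hypotheses (p1 : (1 < p)%E) (pq : hoelder_conjugate p = q%:E).

Lemma conjugate_ge1 : 1 <= q.
Proof. by rewrite -lee_fin -pq hoelder_conj_ge1// ltW. Qed.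

Lemma hoelder_ball (x a : nat -> R) L n : (ellp_norm p x <= 1)%E ->
  (forall j, 0 <= a j) -> 0 < L -> \sum_(j < n) a j `^ q <= L `^ q ->
  \sum_(j < n) a j * `|x j| <= L.
Proof.
move=> x1 a0 L0 aL; apply: (le_trans (young_ball n p1 pq x1 a0 L0)).
have q0 : 0 < q by rewrite (lt_le_trans ltr01 conjugate_ge1).
rewrite -[leRHS]mulr1 ler_wpM2l ?(ltW L0)//.
suff : \sum_(j < n) (a j / L) `^ q <= 1.
  have : 0 <= q^-1 by rewrite invr_ge0 ltW.
  move: q^-1 (\sum_(_ < _) _) => r S r0 S1.
  by rewrite -addrA gerDl addrC subr_le0 ler_piMr.
have Lq : 0 < L `^ q by rewrite powR_gt0.
apply: (@le_trans _ _ (\sum_(j < n) a j `^ q * (L `^ q)^-1)).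
  apply: ler_sum => j _; rewrite powRM ?invr_ge0 ?(ltW L0)//.
  by rewrite -[L^-1]powR_inv1 ?(ltW L0)// -powRrM mulN1r powRN.
by rewrite -mulr_suml ler_pdivrMr// mul1r.
Qed.

(** From [t <= exp t] at [t = |s| / D].  With [D = sqrt (q m)] the right-hand
    side has expectation of order [C^q (q m)^(q/2)] for a sum [s] of [m] random
    signs, which is the growth of the [q]-th moment. *)
Lemma powR_le_exp (s D : R) : 0 < D ->
  `|s| `^ q <= D `^ q * (expR (q / D * s) + expR (- (q / D * s))).
Proof.
move=> D0; have q0 : 0 <= q by rewrite (le_trans ler01 conjugate_ge1).
have sD : `|s| <= D * expR (`|s| / D).
  rewrite mulrC -ler_pdivrMr//; apply: le_trans (expR_ge1Dx _); lra.
apply: (@le_trans _ _ ((D * expR (`|s| / D)) `^ q)).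
  by apply: ge0_ler_powR; rewrite ?nnegrE// mulr_ge0 ?expR_ge0// ltW.
rewrite powRM ?expR_ge0 ?(ltW D0)// ler_wpM2l ?powR_ge0//.
rewrite -expRM (_ : `|s| / D * q = q / D * `|s|); last by ring.
have := expR_ge0 (q / D * s); have := expR_ge0 (- (q / D * s)).
by have [_|_] := ger0P s; rewrite ?mulrN; lra.
Qed.

Variable sigma : nat -> R.
Hypothesis sigma0 : forall j, 0 <= sigma j.

(** The majorant comes from Young's inequality with a free parameter [L], whose
    size is that of the expected dual norm, [sqrt (q m)] times the weighted norm
    [W] of [sigma].  Since [W] is an upper bound for that norm, [L] can be
    positive even when [sigma] vanishes from [k] on. *)
Lemma gelfand_diag_pgt1 n (k W : R) : (0 < n)%N -> 0 < k -> k <=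
  n%:R / 4 -> 0 < W ->
  (\sum_(0 <= j <oo | (k <= j.+1%:R)%R) (sigma j `^ q)%:E <= (W `^ q)%:E)%E ->
  (gelfand_number p 2%:E (diag_op sigma) n <=
   ((16 * expR 2 + 1) * Num.sqrt q / Num.sqrt n%:R * W)%:E)%E.
Proof.
move=> n0 k_gt0 kn W0 sumW.
have q1 := conjugate_ge1; have q0 : 0 < q by rewrite (lt_le_trans ltr01 q1).
have p1' := ltW p1.
(* Every coordinate of weight zero is among the first [k0], where [x] vanishes. *)
pose tau j := if k <= j.+1%:R then sigma j else 0.
have tau0 j : 0 <= tau j by rewrite /tau; case: ifP.
have tauq0 j : 0 <= tau j `^ q by exact: powR_ge0.
have tauE a b : \sum_(a <= j < b) tau j `^ q =
    \sum_(a <= j < b | k <= j.+1%:R) sigma j `^ q.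
  rewrite [RHS]big_mkcond; apply: eq_bigr => j _; rewrite /tau.
  by case: ifP => // _; rewrite powR0// gt_eqF.
have sum_tau b : \sum_(j < b) tau j `^ q <= W `^ q.
  rewrite -(big_mkord xpredT (fun j => tau j `^ q)) tauE -lee_fin -sumEFin.
  apply: le_trans sumW; apply: nneseries_lim_ge => j _ _.
  by rewrite lee_fin powR_ge0.
have sq1 : 1 <= Num.sqrt q by rewrite -sqrtr1 ler_wsqrtr.
have e2 : 1 <= expR (2 : R) by apply: le_trans (expR_ge1Dx _); lra.
have sn : 0 < Num.sqrt n%:R :> R by rewrite sqrtr_gt0 ltr0n.
have [n1|n1] := leqP n 1.
  have {n0 n1}n1 : n = 1%N by apply/eqP; rewrite eqn_leq n1.
  have sigma_tau j : sigma j = tau j.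
    rewrite /tau ifT//; apply: (le_trans kn).
    rewrite n1 -natr1; have := ler0n R j; lra.
  apply: (@le_trans _ _ W%:E).
    apply: gelfand_diag_tail => // x x1 b.
    rewrite big_mkord (eq_bigr (fun j : 'I_b => tau j * `|x j|)).
      by apply: hoelder_ball.
    by move=> j _; rewrite normrM sigma_tau ger0_norm.
  rewrite lee_fin n1 sqrtr1 divr1 ler_peMl ?(ltW W0)//.
  by apply: (le_trans sq1); rewrite ler_peMl ?sqrtr_ge0//; lra.
have [k0 [m [k0m m0 nm k0k]]] := split_codimension n1 k_gt0 kn.
have Wn : 0 < W / Num.sqrt n%:R by rewrite divr_gt0.
have [M k0M tailM] : exists2 M, (k0 <= M)%N &
    forall b, \sum_(M <= j < b) tau j `^ q <= (W / Num.sqrt n%:R) `^ q.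
  have fin : (\sum_(0 <= j <oo | (k <= j.+1%:R)%R) (sigma j `^ q)%:E < +oo)%E.
    by apply: le_lt_trans sumW _; rewrite ltry.
  have tail := nneseries_tail_cvg fin (fun j _ => (powR_ge0 _ _ : (0 <=
    (sigma j `^ q)%:E)%E)).
  have Wq : (0 < ((W / Num.sqrt n%:R) `^ q)%:E)%E by rewrite lte_fin powR_gt0.
  have [M0 _ M0P] := tail _ (open_ereal_lt' Wq).
  exists (maxn k0 M0); rewrite ?leq_maxl// => b.
  rewrite tauE -lee_fin -sumEFin.
  apply: (le_trans _ (ltW (M0P (maxn k0 M0) (leq_maxr _ _)))).
  by apply: nneseries_lim_ge => j _ _; rewrite lee_fin powR_ge0.
(* The factor [2 * expR 2] in [L] absorbs the [2 * expR (2 * q)] that bounds the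
   expectation of the two exponentials, because [2 <= 2 `^ q]. *)
pose D := Num.sqrt (q * m%:R).
have qm0 : 0 < q * m%:R by rewrite mulr_gt0// ltr0n.
have D0 : 0 < D by rewrite sqrtr_gt0.
have D2 : D ^+ 2 = q * m%:R by rewrite sqr_sqrtr// ltW.
pose L := 2 * expR 2 * D * W.
have L0 : 0 < L by rewrite !mulr_gt0// (lt_le_trans ltr01 e2).
have sumM : \sum_(j < M) (tau j * D / L) `^ q * (2 * expR (2 * q)) <= 1.
  rewrite -mulr_suml.
  have -> : \sum_(j < M) (tau j * D / L) `^ q =
      (\sum_(j < M) tau j `^ q) / (2 * expR 2 * W) `^ q.
    rewrite mulr_suml; apply: eq_bigr => j _.
    have -> : tau j * D / L = tau j / (2 * expR 2 * W).
      by rewrite /L; field; rewrite !gt_eqF// (lt_le_trans ltr01 e2).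
    rewrite powRM ?invr_ge0 ?mulr_ge0 ?expR_ge0 ?(ltW W0)//.
    by rewrite -[(_ * W)^-1]powR_inv1 ?mulr_ge0 ?expR_ge0 ?(ltW W0)// -powRrM mulN1r powRN.
  rewrite !powRM ?mulr_ge0 ?expR_ge0 ?(ltW W0)// -expRM.
  have Wq : 0 < W `^ q by rewrite powR_gt0.
  have eq : 0 < expR (2 * q) :> R by exact: expR_gt0.
  have twoq : 2 <= 2 `^ q :> R.
    by rewrite -[leLHS]powRr1// ler_powR// ler1n.
  have h := sum_tau M.
  have S0 : 0 <= \sum_(j < M) tau j `^ q by apply: sumr_ge0.
  move: (\sum_(_ < _) _) (W `^ q) (2 `^ q) (expR (2 * q)) S0 h Wq eq twoq.
  move=> S v a e S0 Sv v0 e0 a2.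
  have a0 : 0 < a by rewrite (lt_le_trans _ a2).
  rewrite (_ : _ * (2 * e) = S * 2 / (v * a)); last by field; rewrite !gt_eqF.
  by rewrite ler_pdivrMr ?mulr_gt0// mul1r ler_pM.
pose c := 2 * L * (1 - q^-1).
pose w (j : 'I_M) := 2 * L * q^-1 * (tau j * D / L) `^ q.
pose l (j : 'I_M) := q / D.
apply: le_trans (@gelfand_diag_window _ p sigma n k0 m M c w l (W / Num.sqrt n%:R) _ _ _ _ _ _) _ => //.
- by move=> j;
  rewrite /w !mulr_ge0 ?powR_ge0 ?invr_ge0 ?expR_ge0 ?(ltW D0) ?(ltW W0) ?(ltW q0).
- move=> x x1 x2.
  have sx j : `|sigma j * x j| = tau j * `|x j|.
    rewrite normrM ger0_norm// /tau; case: ifPn => // nk.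
    rewrite x2 ?normr0 ?mulr0// ltnNge; apply: contra nk; exact: k0k.
  split; last first.
    move=> b; pose a j := if (M <= j)%N then tau j else 0.
    have a0 j : 0 <= a j by rewrite /a; case: ifP.
    have [bM|Mb] := leqP b M; first by rewrite big_geq// ltW.
    have -> : \sum_(M <= j < b) `|sigma j * x j| = \sum_(j < b) a j * `|x j|.
      rewrite -(big_mkord xpredT (fun j => a j * `|x j|)).
      rewrite (big_cat_nat (n := M) (m := 0) (p := b)) ?(ltnW Mb)//=.
      rewrite [X in X + _]big_nat_cond [X in X + _]big1 ?add0r; last first.
        by move=> j /andP[/andP[_ jM] _]; rewrite /a leqNgt jM mul0r.
      apply: eq_big_nat => j /andP[Mj _]; by rewrite sx /a Mj.
    apply: hoelder_ball => //; rewrite -(big_mkord xpredT (fun j => a j `^ q)).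
    rewrite (big_cat_nat (n := M) (m := 0) (p := b)) ?(ltnW Mb)//=.
    rewrite [X in X + _]big_nat_cond [X in X + _]big1 ?add0r; last first.
      by move=> j /andP[/andP[_ jM] _]; rewrite /a leqNgt jM powR0// gt_eqF.
    apply: le_trans (tailM b); apply: ler_sum_nat => j /andP[Mj _].
    by rewrite /a Mj.
  move=> s.
  pose a j := if insub j is Some i then `|s i| * tau j else 0.
  have aE (j : 'I_M) : a j = `|s j| * tau j by rewrite /a valK.
  have a0 j : 0 <= a j by rewrite /a; case: insubP => // i _ _;
    rewrite mulr_ge0.
  have h1 : dot s (fun j => sigma j * x j) <= \sum_(j < M) a j * `|x j|.
    apply: ler_sum => j _; apply: le_trans (ler_norm _) _.
    by rewrite normrM sx aE mulrA.
  have h2 := young_ball M p1 pq x1 a0 L0.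
  have h3 : q^-1 * \sum_(j < M) (a j / L) `^ q <= (2 * L)^-1 * exp_sum w l s.
    rewrite !mulr_sumr; apply: ler_sum => j _; rewrite aE.
    rewrite /w mulrA (_ : (2 * L)^-1 * _ =
      q^-1 * (tau j * D / L) `^ q); last first.
      by field; rewrite !gt_eqF.
    rewrite -[leRHS]mulrA ler_wpM2l ?invr_ge0 ?(ltW q0)//.
    have -> : `|s j| * tau j / L = `|s j| * (tau j / L) by rewrite mulrA.
    have -> : tau j * D / L = tau j / L * D by rewrite mulrAC.
    have tL : 0 <= tau j / L by rewrite divr_ge0// ltW.
    move: (tau j / L) tL => t t0; rewrite !powRM ?(ltW D0)//.
    rewrite mulrC -mulrA ler_wpM2l ?powR_ge0//.
    exact: powR_le_exp.
  apply: (@le_trans _ _ (2 * (L * (1 - q^-1 + q^-1 * \sum_(j < M) (a j / L) `^ q)))).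
    by rewrite ler_wpM2l// (le_trans h1 h2).
  rewrite mulrA mulrDr lerD2l -ler_pdivlMl ?mulr_gt0//.
rewrite lee_fin.
have -> : (16 * expR 2 + 1) * Num.sqrt q / Num.sqrt n%:R * W =
  (16 * expR 2 * Num.sqrt q + Num.sqrt q) / Num.sqrt n%:R * W by ring.
apply: (@le_trans _ _ ((4 * (4 * expR 2 * Num.sqrt q) + 1) / Num.sqrt n%:R * W)); last first.
  rewrite ler_wpM2r ?(ltW W0)// ler_wpM2r ?invr_ge0 ?(ltW sn)//; lra.
apply: window_tail_le => //; last exact: ltW.
have -> : 4 * expR 2 * Num.sqrt q * Num.sqrt m%:R * W = 2 * L.
  by rewrite /L /D sqrtrM ?(ltW q0)//; ring.
have -> : \sum_(j < M) w j * expR (2 * m%:R * l j ^+ 2) =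
    L * q^-1 * \sum_(j < M) (tau j * D / L) `^ q * (2 * expR (2 * q)).
  rewrite mulr_sumr; apply: eq_bigr => j _.
  have -> : 2 * m%:R * l j ^+ 2 = 2 * q.
    rewrite /l expr_div_n D2; field.
    by rewrite pnatr_eq0 -lt0n m0 gt_eqF.
  by rewrite /w; ring.
have Lq : 0 <= L / q by rewrite divr_ge0 ?(ltW L0) ?(ltW q0).
have := ler_piMr Lq sumM; rewrite /c; lra.
Qed.

End PGt1.
End Bounds.

(** * The case p = 1 *)
Section P1.
Variable R : realType.

Lemma sum_inv_sqr_le2 n : \sum_(j < n) (j.+1%:R ^+ 2)^-1 <= 2 :> R.
Proof.
case: n => [|n]; first by rewrite big_ord0.
suff : \sum_(j < n.+1) (j.+1%:R ^+ 2)^-1 <= 2 - n.+1%:R^-1 :> R.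
  by move=> /le_trans; apply; rewrite gerBl.
elim: n => [|n IH]; first by rewrite big_ord1 expr1n invr1; lra.
rewrite big_ord_recr/=; apply: (le_trans (lerD IH (lexx _))).
rewrite -addrA lerD2l -[n.+2]addn1 natrD.
have : 0 < n.+1%:R :> R by [].
move: (n.+1%:R : R) => t t0.
rewrite -subr_ge0.
rewrite (_ : _ - _ = (t * (t + 1) ^+ 2)^-1).
  by rewrite invr_ge0 mulr_ge0 ?exprn_ge0 ?addr_ge0 ?(ltW t0).
by field; rewrite !gt_eqF// addr_gt0.
Qed.

Lemma l1_ball_sum_le (x a : nat -> R) (S : R) n : (ellp_norm 1%:E x <= 1)%E ->
  (forall j, `|a j * x j| <= S * `|x j|) -> 0 <= S ->
  forall k, \sum_(k <= j < n) `|a j * x j| <= S.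
Proof.
move=> x1 aS S0 k.
apply: (@le_trans _ _ (\sum_(k <= j < n) S * `|x j|)).
  by apply: ler_sum_nat => j _; exact: aS.
rewrite -mulr_sumr ler_piMr//.
have h : \sum_(0 <= j < n) `|x j| <= 1.
  have := (ellp_norm_le_real x ltr01 ler01).1 x1 n; rewrite powRr1//.
  by rewrite big_mkord; under eq_bigr => j _ do rewrite powRr1//.
have [kn|nk] := leqP k n; last by rewrite big_geq// ltnW.
apply: le_trans h; rewrite [leRHS](big_cat_nat (n := k))//= lerDr.
exact: sumr_ge0.
Qed.

Variable sigma : nat -> R.
Hypothesis sigma0 : forall j, 0 <= sigma j.

Let logw (j : nat) : R := Num.sqrt (ln j.+1%:R + 1).

Let ln_succ_ge0 (j : nat) : 0 <= ln j.+1%:R :> R.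
Proof. by apply: exp.ln_ge0; rewrite ler1n. Qed.

Let logw_ge1 j : 1 <= logw j.
Proof. by rewrite -[leLHS]sqrtr1 ler_wsqrtr// lerDr. Qed.

Let logw2 j : logw j ^+ 2 = ln j.+1%:R + 1.
Proof. by rewrite sqr_sqrtr// addr_ge0. Qed.

Let exp_logw j : expR (- (2 * logw j ^+ 2)) <= (j.+1%:R ^+ 2)^-1.
Proof.
rewrite expRN lef_pV2 ?posrE ?expR_gt0 ?exprn_gt0// logw2 mulrDr.
apply: (@le_trans _ _ (expR (2 * ln j.+1%:R))); last by rewrite ler_expR lerDl.
by rewrite expRM_natl lnK// posrE.
Qed.

(** For [p = 1] the dual norm is the maximum of [sigma_j |s_j|].  The scale
    [l_j = sqrt (ln (j + 1) + 1) / sqrt m] adapted to the index makes the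
    [exp (l_j |s_j|)] after the discount [exp (- 4 (ln (j + 1) + 1))] summable
    in expectation, so that the union bound over all [j] costs a constant. *)
Lemma gelfand_diag_p1 n (k S : R) : (0 < n)%N -> 0 < k -> k <=
  n%:R / 4 -> 0 < S ->
  (forall j, k <= j.+1%:R -> sigma j * Num.sqrt (ln j.+1%:R + 1) <= S) ->
  (gelfand_number 1%:E 2%:E (diag_op sigma) n <= (65 / Num.sqrt n%:R * S)%:E)%E.
Proof.
move=> n0 k_gt0 kn S0 sigS.
have sn : 0 < Num.sqrt n%:R :> R by rewrite sqrtr_gt0 ltr0n.
have sigmaS j : k <= j.+1%:R -> sigma j <= S.
  move=> /sigS; apply: le_trans; rewrite ler_peMr//; exact: logw_ge1.
have sigma_div j : k <= j.+1%:R -> sigma j <= S / logw j.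
  by move=> /sigS; rewrite ler_pdivlMr// (lt_le_trans ltr01).
have [n1|n1] := leqP n 1.
  have {n0 n1}n1 : n = 1%N by apply/eqP; rewrite eqn_leq n1.
  apply: (@le_trans _ _ S%:E); last first.
    by rewrite lee_fin n1 sqrtr1 divr1 ler_peMl ?(ltW S0)//; lra.
  apply: gelfand_diag_tail => // x x1 b.
  apply: l1_ball_sum_le => // [j|]; last exact: ltW.
  rewrite normrM ger0_norm// ler_wpM2r// sigmaS//; apply: (le_trans kn).
  by rewrite n1 -natr1; have := ler0n R j; lra.
have [k0 [m [k0m m0 nm k0k]]] := split_codimension n1 k_gt0 kn.
have sm : 0 < Num.sqrt m%:R :> R by rewrite sqrtr_gt0 ltr0n.
(* Beyond [exp n] the logarithmic weight alone gives the factor [1 / sqrt n]. *)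
have [M k0M tailM] : exists2 M, (k0 <= M)%N &
    forall j, (M <= j)%N -> Num.sqrt n%:R <= logw j.
  exists (maxn k0 (Num.bound (expR (n%:R : R)))); rewrite ?leq_maxl// => j.
  rewrite geq_max => /andP[_ Mj].
  rewrite ler_wsqrtr// -[leLHS]addr0 lerD// -[leLHS]expRK ler_ln ?posrE ?expR_gt0//.
  apply: (le_trans (ltW (archi_boundP (expR_ge0 _)))).
  by rewrite ler_nat ltnW.
pose c := 8 * Num.sqrt m%:R * S.
pose w (j : 'I_M) := 2 * Num.sqrt m%:R * S * expR (- (4 * logw j ^+ 2)).
pose l (j : 'I_M) := logw j / Num.sqrt m%:R.
have w0 j : 0 <= w j.
  by rewrite !mulr_ge0 ?expR_ge0 ?(ltW sm) ?(ltW S0).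
apply: le_trans (@gelfand_diag_window _ 1%:E sigma n k0 m M c w l (S / Num.sqrt n%:R) _ _ _ _ _ _) _ => //.
- move=> x x1 x2; split; last first.
    move=> b; pose a j := if (M <= j)%N then sigma j else 0.
    have -> : \sum_(M <= j < b) `|sigma j * x j| =
      \sum_(M <= j < b) `|a j * x j|.
      by apply: eq_big_nat => j /andP[Mj _]; rewrite /a Mj.
    apply: l1_ball_sum_le => //; last by rewrite divr_ge0 ?(ltW S0) ?(ltW sn).
    move=> j; rewrite /a; case: ifPn => [Mj|_]; last first.
      by rewrite mul0r normr0 mulr_ge0// divr_ge0 ?(ltW S0) ?(ltW sn).
    rewrite normrM ger0_norm// ler_wpM2r//.
    apply: (le_trans (sigma_div j _)); first by rewrite k0k// (leq_trans k0M).
    by rewrite ler_wpM2l ?(ltW S0)// lef_pV2 ?posrE ?tailM// (lt_le_trans ltr01).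
  move=> s; pose Q := 2^-1 * (c + exp_sum w l s).
  have exp_sum_ge (j : 'I_M) : w j * expR (l j * `|s j|) <= exp_sum w l s.
    rewrite /exp_sum (bigD1 j)//= -[leLHS]addr0 lerD//.
      rewrite ler_wpM2l//.
      have := expR_ge0 (l j * s j); have := expR_ge0 (- (l j * s j)).
      by have [_|_] := ger0P (s j); rewrite ?mulrN; lra.
    apply: sumr_ge0 => i _; rewrite mulr_ge0// addr_ge0 ?expR_ge0//.
  (* [t - A <= exp (t - A)] with [A = 4 (ln (j + 1) + 1)]; dividing by
     [ln (j + 1) + 1 >= 1] turns [A] into the constant 4. *)
  have Qj (j : 'I_M) : (k0 <= j)%N -> `|s j| * sigma j <= Q.
    move=> k0j; apply: (@le_trans _ _ (`|s j| * (S / logw j))).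
      by rewrite ler_wpM2l// sigma_div// k0k.
    have L1 := logw_ge1 j.
    have L0 : 0 < logw j by rewrite (lt_le_trans ltr01).
    have ls : l j * `|s j| <=
      logw j ^+ 2 * (4 + expR (l j * `|s j| - 4 * logw j ^+ 2)).
      set t := l j * `|s j|; set e := expR _.
      have et : t - 4 * logw j ^+ 2 <= e by apply: le_trans (expR_ge1Dx _); lra.
      have e0 : 0 <= e by exact: expR_ge0.
      have : 1 <= logw j ^+ 2 by rewrite expr_ge1// ltW.
      nra.
    have -> : `|s j| * (S / logw j) =
        Num.sqrt m%:R * S / logw j ^+ 2 * (l j * `|s j|).
      by rewrite /l; field; rewrite !gt_eqF.
    apply: (@le_trans _ _ (Num.sqrt m%:R * S * (4 + expR (l j * `|s j| - 4 * logw j ^+ 2)))).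
      rewrite -mulrA ler_wpM2l ?mulr_ge0 ?(ltW sm) ?(ltW S0)//.
      by rewrite ler_pdivrMl ?exprn_gt0.
    have := exp_sum_ge j; rewrite /Q /c /w expRD; lra.
  have Q0 : 0 <= Q.
    rewrite mulr_ge0// addr_ge0 ?mulr_ge0 ?(ltW sm) ?(ltW S0)//.
    by apply: sumr_ge0 => i _; rewrite mulr_ge0// addr_ge0 ?expR_ge0.
  rewrite -ler_pdivlMl// -/Q.
  pose a j := if insub j is Some i then s i * sigma j else 0.
  have aE (j : 'I_M) : a j = s j * sigma j by rewrite /a valK.
  apply: (@le_trans _ _ (\sum_(0 <= j < M) `|a j * x j|)).
    rewrite big_mkord; apply: ler_sum => j _.
    by apply: le_trans (ler_norm _) _; rewrite aE mulrA.
  apply: l1_ball_sum_le => // j; rewrite normrM /a.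
  have [jk0|k0j] := ltnP j k0; first by rewrite x2// normr0 !mulr0.
  rewrite ler_wpM2r//; case: insubP => [i _ ij|_]; last by rewrite normr0.
  by rewrite normrM (ger0_norm (sigma0 j)) -ij Qj// ij.
rewrite lee_fin.
have -> : 65 = 4 * 16 + 1 :> R by ring.
apply: window_tail_le => //; last exact: ltW.
have -> : \sum_(j < M) w j * expR (2 * m%:R * l j ^+ 2) =
    2 * Num.sqrt m%:R * S * \sum_(j < M) expR (- (2 * logw j ^+ 2)).
  rewrite mulr_sumr; apply: eq_bigr => j _.
  rewrite /w -mulrA -expRD; congr (_ * expR _).
  rewrite /l expr_div_n (@sqr_sqrtr _ m%:R) ?ler0n//; field.
  by rewrite pnatr_eq0 -lt0n.
have T2 : \sum_(j < M) expR (- (2 * logw j ^+ 2)) <= 2.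
  by apply: le_trans (sum_inv_sqr_le2 M); apply: ler_sum.
have P0 : 0 <= 2 * Num.sqrt m%:R * S by rewrite !mulr_ge0 ?(ltW sm) ?(ltW S0).
have := ler_wpM2l P0 T2; rewrite /c; lra.
Qed.

End P1.

(** * Passage to the extended reals, and decay of the Gelfand numbers *)
Section Final.
Variable R : realType.

(** The estimates above need a positive [W]; letting [W] decrease to [v] extends
    them to [v = 0]. *)
Lemma le_of_lt_scale (c : \bar R) (K v : R) : 0 <= K ->
  (forall W, v < W -> (c <= (K * W)%:E)%E) -> (c <= (K * v)%:E)%E.
Proof.
move=> K0 h; apply/lee_addgt0Pr => e e0.
have K1 : 0 < K + 1 by lra.
have := h (v + e / (K + 1)); rewrite ltrDl divr_gt0// => /(_ isT).
move=> /le_trans; apply; rewrite -EFinD lee_fin mulrDr lerD2l.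
by rewrite mulrCA ger_pMr// ler_pdivrMr// mul1r; lra.
Qed.

(** If [|x_i|] exceeds [B / sqrt (j + 1)] then [i < j], so that level is exceeded
    by at most [j] terms. *)
Lemma lorentz2oo_le (x : nat -> R) (B : R) :
  (forall j, `|x j| <= B / Num.sqrt j.+1%:R) -> lorentz2oo x.
Proof.
move=> xB; have B0 : 0 <= B.
  by have := xB 0%N; rewrite sqrtr1 divr1; apply: le_trans.
apply: (@le_lt_trans _ _ B%:E); last by rewrite ltry.
apply: ge_ereal_sup => _ [j _ <-].
have s0 : 0 < Num.sqrt j.+1%:R :> R by rewrite sqrtr_gt0.
have -> : B = Num.sqrt j.+1%:R * (B / Num.sqrt j.+1%:R) by field;
  rewrite gt_eqF.
rewrite EFinM lee_wpmul2l ?lee_fin ?sqrtr_ge0//.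
apply: ereal_inf_lbound; exists (B / Num.sqrt j.+1%:R) => //; split.
  by rewrite divr_ge0// ltW.
have sub : [set i | B / Num.sqrt j.+1%:R < `|x i|] `<=` `I_j.
  move=> i /= h; rewrite ltnNge; apply/negP => ji.
  have := lt_le_trans h (xB i); rewrite ltNge => /negP; apply.
  by rewrite ler_wpM2l// lef_pV2 ?posrE ?sqrtr_gt0// ler_wsqrtr// ler_nat.
have fin := sub_finite_set sub (finite_II j).
rewrite /counting asboolT// lee_fin ler_nat.
by apply: geq_card_fset_set; exact: subset_card_le.
Qed.

Lemma gelfand_bound_p1 (sigma : nat -> R) n (k : R) :
  (forall j, 0 <= sigma j) -> (0 < n)%N -> 0 < k -> k <= n%:R / 4 ->
  (gelfand_number 1 2%:E (diag_op sigma) n <= (65 / Num.sqrt n%:R)%:E *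
    ereal_sup [set (sigma j * Num.sqrt (ln j.+1%:R + 1))%:E |
               j in [set j : nat | (k <= j.+1%:R)%R]])%E.
Proof.
move=> sigma0 n0 k_gt0 kn.
have sn : 0 < Num.sqrt n%:R :> R by rewrite sqrtr_gt0 ltr0n.
have C0 : 0 < 65 / Num.sqrt n%:R :> R by rewrite divr_gt0.
set A := [set _ | _ in _].
have ub j : k <= j.+1%:R ->
    ((sigma j * Num.sqrt (ln j.+1%:R + 1))%:E <= ereal_sup A)%E.
  by move=> kj; apply: ereal_sup_ubound; exists j.
have sup0 : (0 <= ereal_sup A)%E.
  apply: le_trans (ub (Num.bound k) _).
    by rewrite lee_fin mulr_ge0// sqrtr_ge0.
  by apply: (le_trans (ltW (archi_boundP (ltW k_gt0)))); rewrite ler_nat.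
case: (ereal_sup A) sup0 ub => [v||//] v0 ub; last first.
  by rewrite gt0_muley ?lte_fin// leey.
rewrite -EFinM; apply: le_of_lt_scale => [|W vW]; first exact: ltW.
apply: (gelfand_diag_p1 sigma0 n0 k_gt0 kn); first exact: le_lt_trans vW.
by move=> j kj; rewrite (le_trans _ (ltW vW))// -lee_fin ub.
Qed.

Lemma gelfand_bound_pgt1 (p : \bar R) (q : R) (sigma : nat -> R) n (k : R) :
  (1 < p)%E -> hoelder_conjugate p = q%:E ->
  (forall j, 0 <= sigma j) -> (0 < n)%N -> 0 < k -> k <= n%:R / 4 ->
  (gelfand_number p 2%:E (diag_op sigma) n <=
    ((16 * expR 2 + 1) * Num.sqrt q / Num.sqrt n%:R)%:E *
    (\sum_(0 <= j <oo | (k <= j.+1%:R)%R) (sigma j `^ q)%:E) `^ q^-1)%E.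
Proof.
move=> p1 pq sigma0 n0 k_gt0 kn.
have sn : 0 < Num.sqrt n%:R :> R by rewrite sqrtr_gt0 ltr0n.
have q1 := conjugate_ge1 p1 pq; have q0 : 0 < q by rewrite (lt_le_trans ltr01).
set K := (16 * expR 2 + 1) * Num.sqrt q / Num.sqrt n%:R.
have K0 : 0 < K.
  by rewrite divr_gt0// mulr_gt0 ?sqrtr_gt0// ltr_wpDl// mulr_ge0 ?expR_ge0.
set S := (\sum_(_ <= _ <oo | _) _)%E.
have : (0 <= S)%E by apply: nneseries_ge0 => j _ _; rewrite lee_fin powR_ge0.
move ES : S => V; case: V ES => [v||//] ES v0; last first.
  by rewrite poweRyr ?gt_eqF ?invr_gt0// gt0_muley ?leey ?lte_fin.
rewrite poweR_EFin -EFinM; apply: le_of_lt_scale => [|W vW]; first exact: ltW.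
have W0 : 0 < W by apply: le_lt_trans vW; exact: powR_ge0.
apply: (gelfand_diag_pgt1 p1 pq sigma0 n0 k_gt0 kn W0).
rewrite -/S ES lee_fin -[v]powRr1// -(@mulVf _ q) ?gt_eqF// powRrM.
by apply: ge0_ler_powR; rewrite ?nnegrE ?powR_ge0 ?(ltW q0) ?(ltW W0) ?(ltW vW).
Qed.

Lemma gelfand_decay (p : \bar R) (q : R) (sigma : nat -> R) :
  (1 < p)%E -> hoelder_conjugate p = q%:E ->
  (forall j, 0 <= sigma j) -> ellp q%:E sigma ->
  exists B : R, forall n, (0 < n)%N ->
    (gelfand_number p 2%:E (diag_op sigma) n <= (B / Num.sqrt n%:R)%:E)%E.
Proof.
move=> p1 pq sigma0 sq.
have q1 := conjugate_ge1 p1 pq; have q0 : 0 < q by rewrite (lt_le_trans ltr01).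
have nf : ellp_norm q%:E sigma \is a fin_num by rewrite ge0_fin_numE ?ellp_norm_ge0.
pose W := fine (ellp_norm q%:E sigma) + 1.
have W0 : 0 < W by rewrite ltr_wpDl// fine_ge0// ellp_norm_ge0.
have sW : (ellp_norm q%:E sigma <= W%:E)%E.
  by rewrite -[leLHS](fineK nf) lee_fin lerDl.
have sum_le := (ellp_norm_le_real sigma q0 (ltW W0)).1 sW.
exists ((16 * expR 2 + 1) * Num.sqrt q * W) => n n0.
have n4 : 0 < n%:R / 4 :> R by rewrite divr_gt0 ?ltr0n.
have := @gelfand_diag_pgt1 _ p q p1 pq sigma sigma0 n (n%:R / 4) W n0 n4 (lexx _) W0.
rewrite [_ * W / _]mulrAC; apply.
have pow0 j : (0 <= (sigma j `^ q)%:E)%E by rewrite lee_fin powR_ge0.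
apply: lime_le; first by apply: is_cvg_nneseries => *; exact: pow0.
near=> b; rewrite sumEFin lee_fin; apply: le_trans (sum_le b).
rewrite -(big_mkord xpredT (fun j => `|sigma j| `^ q)) big_mkcond/=.
by apply: ler_sum => j _; case: ifP => _; rewrite ?powR_ge0// ger0_norm.
Unshelve. all: by end_near. Qed.

End Final.

Theorem corollary3 (R : realType) :
  exists C a b : R,
    [/\ 0 < C, 0 < a, a <= b &
    forall (p : \bar R) (sigma : nat -> R),
      (1 <= p)%E ->
      nonincreasing_seq sigma ->
      (forall j, 0 <= sigma j) ->
      let c_ n := gelfand_number p 2%:E (diag_op sigma) n in
      let ps := fine (hoelder_conjugate p) in
      (forall n : nat, (0 < n)%N ->
         exists k : R,
           [/\ 0 < k,
               (p = 1%E ->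
                  a * n%:R <= k <= b * n%:R /\
                  (c_ n <= (C / Num.sqrt n%:R)%:E *
                     ereal_sup [set (sigma j * Num.sqrt (ln j.+1%:R + 1))%:E |
                                j in [set j : nat | (k <= j.+1%:R)%R]])%E) &
               ((1 < p)%E ->
                  a * (n%:R / ps) <= k <= b * (n%:R / ps) /\
                  (c_ n <= (C * Num.sqrt ps / Num.sqrt n%:R)%:E *
                     (\sum_(0 <= j <oo | (k <= j.+1%:R)%R)
                        (sigma j `^ ps)%:E) `^ ps^-1)%E)]) /\
      ((1 < p)%E -> ellp (hoelder_conjugate p) sigma ->
         (forall n : nat, c_ n.+1 \is a fin_num) /\
         lorentz2oo (fun n : nat => fine (c_ n.+1)))].
Proof.
have e2 : 0 < expR (2 : R) by exact: expR_gt0.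
(* With [a = b], [k] is forced to be [n / 4] or [n / (4 p^* )]; the two summands
   of [C] serve [p > 1] and [p = 1]. *)
exists (16 * expR 2 + 65), 4^-1, 4^-1; split=> //.
move=> p sigma p1 _ sigma0 c_ ps.
have psE : (1 < p)%E -> hoelder_conjugate p = ps%:E.
  move=> lt1p; rewrite /ps fineK// ge0_fin_numE; last first.
    by rewrite (le_trans lee01)// hoelder_conj_ge1.
  by rewrite ltey; apply/eqP => /hoelder_conjugate_eqy p_eq1;
    rewrite p_eq1 ltxx in lt1p.
split=> [n n0|lt1p].
  have nR : 0 < n%:R :> R by rewrite ltr0n.
  have sn : 0 < Num.sqrt n%:R :> R by rewrite sqrtr_gt0.
  have [p_eq1|p_neq1] := eqVneq p 1%E.
    exists (4^-1 * n%:R); split; [by rewrite mulr_gt0| |by rewrite p_eq1 ltxx].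
    move=> _; split; first by rewrite lexx.
    rewrite /c_ p_eq1; apply: le_trans (gelfand_bound_p1 (k := 4^-1 * n%:R) sigma0 n0 _ _) _.
    - by rewrite mulr_gt0.
    - by rewrite mulrC.
    apply: lee_wpmul2r;
      last by rewrite lee_fin ler_wpM2r ?invr_ge0 ?(ltW sn)//; lra.
    apply: le_trans (ereal_sup_ubound _); last first.
      exists (Num.bound (4^-1 * n%:R : R)) => //=.
      apply: (le_trans (ltW (archi_boundP _))); first by rewrite mulr_ge0// ltW.
      by rewrite ler_nat.
    by rewrite lee_fin mulr_ge0// sqrtr_ge0.
  have lt1p : (1 < p)%E by rewrite lt_neqAle eq_sym p_neq1.
  have ps1 := conjugate_ge1 lt1p (psE lt1p).
  have ps0 : 0 < ps by rewrite (lt_le_trans ltr01).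
  have k0 : 0 < 4^-1 * (n%:R / ps) by rewrite mulr_gt0// divr_gt0.
  exists (4^-1 * (n%:R / ps)); split=> // [p_eq1|_].
    by rewrite p_eq1 eqxx in p_neq1.
  split; first by rewrite lexx.
  apply: le_trans (gelfand_bound_pgt1 lt1p (psE lt1p) sigma0 n0 k0 _) _.
    by rewrite mulrC ler_wpM2r// ler_piMr ?(ltW nR)// invf_le1.
  apply: lee_wpmul2r; first exact: poweR_ge0.
  by rewrite lee_fin !ler_wpM2r ?invr_ge0 ?sqrtr_ge0//; lra.
rewrite (psE lt1p) => sq.
have [B cB] := gelfand_decay lt1p (psE lt1p) sigma0 sq.
have cfin n : c_ n.+1 \is a fin_num.
  rewrite ge0_fin_numE; last exact: gelfand_ge0.
  by apply: (le_lt_trans (cB n.+1 isT)); rewrite ltry.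
split=> //; apply: (@lorentz2oo_le _ _ B) => j.
rewrite ger0_norm; last by rewrite fine_ge0// gelfand_ge0.
by rewrite -lee_fin fineK// cB.
Qed.
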